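(* For any positive integer $n$, modulo $\Phi_n(q)^2$, $$\left(\!\!\binom{2n}{0}\!\!\right)_q\equiv\begin{cases}2(-1)^m(1+q^m)q^{m(3m-1)/2}-9m(1-q^{3m})+1,&\text{if } n=3m,\\ 2(-1)^mq^{m(3m+1)/2}-3(3m+1)(1-q^{3m+1})+1,&\text{if } n=3m+1,\\ 2(-1)^mq^{m(3m-1)/2}-3(3m-1)(1-q^{3m-1})+1,&\text{if } n=3m-1,\end{cases}$$ where in each case $m$ is the integer determined by $n$.
   Context: $q$ is an indeterminate. $\Phi_n(q)=\prod_{1\le k\le n,\ \gcd(n,k)=1}(q-\zeta^k)$, with $\zeta$ a primitive $n$-th root of unity, is the $n$-th cyclotomic polynomial. The $q$-shifted factorial is $(a;q)_0=1$, $(a;q)_n=(1-a)(1-aq)\cdots(1-aq^{n-1})$ for $n\ge 1$. The $q$-binomial coefficient is $\begin{bmatrix}n\\k\end{bmatrix}=\frac{(q;q)_n}{(q;q)_k(q;q)_{n-k}}$ if $0\le k\le n$, and $0$ otherwise. For integers $n\ge 0$ and $-n\le j\le n$, the $q$-trinomial coefficient is $$\left(\!\!\binom{n}{j}\!\!\right)_q=\sum_{k=0}^{n}q^{k(k+j)}\begin{bmatrix}n\\k\end{bmatrix}\begin{bmatrix}n-k\\k+j\end{bmatrix}.$$ A congruence $A(q)\equiv B(q)$ modulo $\Phi_n(q)^2$ means that $\Phi_n(q)^2$ divides $A(q)-B(q)$ in $\mathbb{Z}[q,q^{-1}]$. *)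

(* Defs.v *)
From HB Require Import structures.
From mathcomp Require Import all_boot all_order all_algebra all_field.

Set Implicit Arguments.
Unset Strict Implicit.
Unset Printing Implicit Defensive.

Import GRing.Theory.
Local Open Scope ring_scope.

(* Everything lives in Q(q), the fraction field of Z[q]. *)
Notation Qq := {fraction {poly int}}.
Notation "''q'" := (tofrac ('X : {poly int})) : ring_scope.

(* Z[q, q^-1] as a subring of Q(q). *)
Definition laurent (f : Qq) : Prop :=
  exists (p : {poly int}) (N : nat), f = tofrac p / 'q ^+ N.

Definition laurent_dvd (M F : Qq) : Prop :=
  exists2 C : Qq, laurent C & F = M * C.

Definition congr_mod (M A B : Qq) : Prop := laurent_dvd M (A - B).

(* (a; q)_n *)
Definition qpoch (a : Qq) (n : nat) : Qq := \prod_(i < n) (1 - a * 'q ^+ i).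

Definition qbinom (n : nat) (k : int) : Qq :=
  if 0 <= k <= n%:Z
  then qpoch 'q n / (qpoch 'q `|k|%N * qpoch 'q `|n%:Z - k|%N)
  else 0.

(* The q-trinomial coefficient ((n, j))_q; meaningful for -n <= j <= n. *)
Definition qtrinom (n : nat) (j : int) : Qq :=
  \sum_(k < n.+1)
    'q ^ (k%:Z * (k%:Z + j)) * qbinom n k%:Z * qbinom (n - k) (k%:Z + j).

(* Main.v *)
Require Import Defs.
From mathcomp Require Import all_boot all_order all_algebra all_field.
From mathcomp Require Import ring zify.

(** Write u = q^n and [N;k] for the Gaussian binomial. The congruence is the
    shadow of the exact identity

      F_n = sum_k (-1)^k q^C(k,2) (1 - u)/(1 - q^(n-k)) [n-k;k]
          = (-1)^m (1 + q^m) q^(m(3m-1)/2)   if n = 3m,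
            (-1)^m q^(m(3m+1)/2)             if n = 3m + 1,
            (-1)^m q^(m(3m-1)/2)             if n = 3m - 1,

    because its right-hand sides all read 2 F_n - 3n (1 - u) + 1, and the
    central trinomial sum_k T_k, with T_k = q^(k^2) [2n;k] [2n-k;k], agrees
    with this term by term.

    - k = 0: T_0 = 1, while 2 F_n contributes 2.
    - 0 < k < n: T_k is congruent to twice the k-th term of F_n. After
      multiplication by (q;q)_k^2 both become 1 - u times a product which need
      only be compared modulo 1 - u. There q^n = 1, and turning q^(k^2) times
      the factors 1 - q^(2n-j) into the factors 1 - q^j is a matter of
      distributing powers of q (qffact_eqmod_qfact, trinterm_eqmod).
    - k = n: T_n = q^(n^2) [2n;n] is congruent to 2 - 3n (1 - u)
      (central_eqmod). Writing [2n;n] (q;q)_(n-1) = (1 + u) A with A the product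
      of the 1 - q^(n+j), 0 < j < n, one pairs j with n - j in A^2 to get
      A^2 = u^(n-1) (q;q)_(n-1)^2 modulo (1 - u)^2, and then extracts A to
      first order around (q;q)_(n-1).
    - The two constants 2 - 3n (1 - u) and 1 add up to the constant 2 of 2 F_n
      plus 1 - 3n (1 - u), which accounts for the whole right-hand side.

    Thus (q;q)_(n-1)^2 times the difference of the two sides is divisible by
    (1 - q^n)^2, hence by Phi_n^2, already in Z[q]; and Phi_n is coprime to
    (q;q)_(n-1), since a primitive n-th root of unity is no j-th root of unity
    for 0 < j < n. As Phi_n is monic, the factor (q;q)_(n-1)^2 can be cancelled
    over Z (eqmod_Cyclotomic).

    For the identity, F_n = G_n - q^(n-1) G_(n-2) with
    G_n = sum_k (-1)^k q^C(k,2) [n-k;k], and the two q-Pascal rules show that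
    G_(n+3) = - q^(n+1) G_n (altsum_rec3). *)

Set Implicit Arguments.
Unset Strict Implicit.
Unset Printing Implicit Defensive.

Import GRing.Theory.
Local Open Scope ring_scope.

(** * Gaussian binomials and q-factorials *)

Section GaussianBinomials.
Variables (R : comNzRingType) (q : R).

(** The q-Pascal rule is taken as definition so that integrality in q is built
    in; gauss_qfact recovers the quotient of q-shifted factorials. *)
Fixpoint gauss (n k : nat) : R :=
  match n, k with
  | _, 0 => 1
  | 0, _.+1 => 0
  | n'.+1, k'.+1 => gauss n' k' + q ^+ k'.+1 * gauss n' k'.+1
  end.

(** The q-shifted factorial (q; q)_k. *)
Definition qfact (k : nat) : R := \prod_(j < k) (1 - q ^+ j.+1).

(** When n < k the truncated subtraction produces a factor 1 - q^0 = 0, so that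
    the formula gauss_qfact holds for all n and k. *)
Definition qffact (n k : nat) : R := \prod_(j < k) (1 - q ^+ (n - j)).

Lemma gaussS n k :
  gauss n.+1 k.+1 = gauss n k + q ^+ k.+1 * gauss n k.+1.
Proof. by []. Qed.

Lemma gauss0 n : gauss n 0 = 1.
Proof. by case: n. Qed.

Lemma gauss_small n k : (n < k)%N -> gauss n k = 0.
Proof.
elim: n k => [|n IHn] [|k] //= lt_nk.
by rewrite !IHn ?mulr0 ?addr0 // ltnW.
Qed.

Lemma gaussnn n : gauss n n = 1.
Proof. by elim: n => //= n ->; rewrite gauss_small // mulr0 addr0. Qed.

(** The other q-Pascal rule, with the power of q on the other summand. *)
Lemma gaussS_dual n k : (k <= n)%N ->
  gauss n.+1 k.+1 = gauss n k.+1 + q ^+ (n - k) * gauss n k.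
Proof.
elim: n k => [|n IHn] k le_kn.
  by case: k le_kn => //= _; rewrite !mulr0 !addr0 subnn expr0 mulr1 add0r.
have [->|ne_kn] := eqVneq k n.+1.
  by rewrite gaussnn subnn expr0 gauss_small // gaussnn; ring.
have {ne_kn} : (k <= n)%N by lia.
case: k le_kn => [|k] _ le_kn.
  rewrite (gaussS n.+1) {1}(IHn 0) // (gaussS n) !gauss0 !subn0 !exprS.
  by rewrite expr0; ring.
transitivity (gauss n k.+1 + q ^+ (n - k) * gauss n k
    + q ^+ k.+2 * (gauss n k.+2 + q ^+ (n - k.+1) * gauss n k.+1)).
  by rewrite -!IHn // ltnW.
rewrite subSS !gaussS.
have -> : (n - k = (n - k.+1).+1)%N by lia.
rewrite !exprS; ring.
Qed.

Lemma gauss_sym a b : gauss (a + b) a = gauss (a + b) b.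
Proof.
elim: a b => [|a IHa] b; first by rewrite add0n gauss0 gaussnn.
elim: b => [|b IHb]; first by rewrite addn0 gauss0 gaussnn.
rewrite addSn gaussS (IHa b.+1) gaussS_dual; last by lia.
by rewrite -addSnnS IHb addnK.
Qed.

Lemma qfactS k : qfact k.+1 = qfact k * (1 - q ^+ k.+1).
Proof. exact: big_ord_recr. Qed.

Lemma qffactS n k : qffact n.+1 k.+1 = (1 - q ^+ n.+1) * qffact n k.
Proof. by rewrite /qffact big_ord_recl. Qed.

Lemma qffactSr n k : qffact n k.+1 = qffact n k * (1 - q ^+ (n - k)).
Proof. exact: big_ord_recr. Qed.

Lemma qffactD n k l : qffact n (k + l) = qffact n k * qffact (n - k) l.
Proof.
rewrite /qffact big_split_ord /=; congr (_ * _).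
by apply: eq_bigr => j _; rewrite subnDA.
Qed.

Lemma qffact_small n k : (n < k)%N -> qffact n k = 0.
Proof.
by move=> lt_nk; rewrite /qffact (bigD1 (Ordinal lt_nk)) //= subnn subrr mul0r.
Qed.

Lemma qffactnn n : qffact n n = qfact n.
Proof.
rewrite /qffact /qfact (reindex_inj rev_ord_inj) /=.
by apply: eq_bigr => j _; rewrite subKn.
Qed.

Lemma gauss_qfact n k : gauss n k * qfact k = qffact n k.
Proof.
elim: n k => [|n IHn] [|k].
- by rewrite gauss0 /qfact /qffact !big_ord0 mulr1.
- by rewrite gauss_small // mul0r qffact_small.
- by rewrite gauss0 /qfact /qffact !big_ord0 mulr1.
have -> : gauss n.+1 k.+1 * qfact k.+1 = gauss n k * qfact k * (1 - q ^+ k.+1)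
    + q ^+ k.+1 * (gauss n k.+1 * qfact k.+1).
  by rewrite gaussS qfactS; ring.
rewrite !IHn qffactS qffactSr.
have [le_kn|lt_nk] := leqP k n; last by rewrite (qffact_small lt_nk); ring.
have -> : n.+1 = (k.+1 + (n - k))%N by lia.
by rewrite exprD; ring.
Qed.

End GaussianBinomials.

(** * The pentagonal sum *)

Section PentagonalSums.
Variables (R : comNzRingType) (q : R).
Local Notation gauss := (gauss q).

(** The sum G_n; its summands with n/2 < k vanish. *)
Definition altsum (n : nat) : R :=
  \sum_(k < n.+1) (-1) ^+ k * q ^+ 'C(k, 2) * gauss (n - k) k.

(** Companion of altsum: either q-Pascal rule changes the power of q attached to
    the k-th term, and the recurrences close up on these two sums. *)
Definition altsumq (n : nat) : R :=
  \sum_(k < n.+1) (-1) ^+ k * q ^+ 'C(k, 2) * q ^+ (n - k) * gauss (n - k) k.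

Lemma altsumSS n : altsum n.+2 = altsum n.+1 - altsumq n.
Proof.
rewrite /altsum big_ord_recr /= subnn mulr0 addr0.
rewrite big_ord_recl [in RHS]big_ord_recl /= ?gauss0 -addrA; congr (_ + _).
rewrite -sumrB; apply: eq_bigr => i _; rewrite /bump /= add1n.
have le_in : (i <= n)%N by case: i.
have -> : (n.+2 - i.+1 = (n - i).+1)%N by lia.
rewrite (_ : n.+1 - i.+1 = n - i)%N //.
have [le_ini|lt] := leqP i (n - i).
  rewrite gaussS_dual // mulrDr; congr (_ + _).
  have -> : (n - i = i + (n - i - i))%N by lia.
  rewrite addKn [in RHS]exprD exprS binS bin1 !exprD; ring.
rewrite !gauss_small; [ring| lia | lia | lia].
Qed.

Lemma altsumqSS n :
  altsumq n.+2 = q ^+ n.+2 * altsum n.+1 - q ^+ n.+1 * altsum n.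
Proof.
rewrite /altsum /altsumq big_ord_recr /= subnn mulr0 addr0.
rewrite big_ord_recl [\sum_(_ < n.+2) _]big_ord_recl /= ?gauss0 mulrDr -addrA.
congr (_ + _); first by rewrite !subn0; ring.
rewrite !mulr_sumr -sumrB; apply: eq_bigr => i _; rewrite /bump /= add1n.
have le_in : (i <= n)%N by case: i.
have -> : (n.+2 - i.+1 = (n - i).+1)%N by lia.
rewrite (_ : n.+1 - i.+1 = n - i)%N // gaussS.
have -> : q ^+ n.+2 = q ^+ (n - i).+1 * q ^+ i.+1.
  by rewrite -exprD; congr (_ ^+ _); lia.
have -> : q ^+ n.+1 = q ^+ (n - i).+1 * q ^+ i.
  by rewrite -exprD; congr (_ ^+ _); lia.
rewrite binS bin1 !exprD !exprS; ring.
Qed.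

(** Eliminating altsumq gives a recurrence of order 4 saying that
    G_(n+3) + q^(n+1) G_n does not depend on n; it vanishes for n = 0. *)
Lemma altsum_rec3 n : altsum n.+3 = - q ^+ n.+1 * altsum n.
Proof.
have altsum0 : altsum 0 = 1 by rewrite /altsum big_ord1 /= expr0 !mulr1.
have altsum1 : altsum 1 = 1.
  by rewrite /altsum big_ord_recl big_ord1 /= expr0; ring.
have altsumq0 : altsumq 0 = 1 by rewrite /altsumq big_ord1 /= expr0 !mulr1.
have altsumq1 : altsumq 1 = q.
  rewrite /altsumq big_ord_recl big_ord1 /=; ring.
elim: n => [|n IHn].
  by rewrite !altsumSS altsum0 altsum1 altsumq0 altsumq1; ring.
by rewrite altsumSS altsumqSS IHn; ring.
Qed.

Lemma altsum_mod0 m : altsum (3 * m) = (-1) ^+ m * q ^+ (3 * 'C(m, 2) + m).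
Proof.
elim: m => [|m IHm]; first by rewrite /altsum big_ord1 /= expr0 !mulr1.
rewrite mulnS addnC addn3 altsum_rec3 IHm.
have -> : (3 * 'C(m.+1, 2) + m.+1 = (3 * m).+1 + (3 * 'C(m, 2) + m))%N.
  by rewrite binS bin1; lia.
by rewrite !exprD !exprS; ring.
Qed.

Lemma altsum_mod1 m :
  altsum (3 * m).+1 = (-1) ^+ m * q ^+ (3 * 'C(m, 2) + 2 * m).
Proof.
elim: m => [|m IHm].
  by rewrite /altsum big_ord_recl big_ord1 /= expr0; ring.
rewrite mulnS addnC addn3 altsum_rec3 IHm.
have -> : (3 * 'C(m.+1, 2) + 2 * m.+1 = (3 * m).+2 + (3 * 'C(m, 2) + 2 * m))%N.
  by rewrite binS bin1; lia.
by rewrite !exprD !exprS; ring.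
Qed.

Lemma altsum_mod2 m : altsum (3 * m).+2 = 0.
Proof.
elim: m => [|m IHm]; last by rewrite mulnS addnC addn3 altsum_rec3 IHm mulr0.
by rewrite /altsum !big_ord_recl big_ord0 /= expr0; ring.
Qed.

(** The k-th term of F_n. For 0 < k < n, the sum in parentheses is the
    division-free form of (1 - q^n)/(1 - q^(n-k)) [n-k;k]. *)
Definition pentterm (n k : nat) : R :=
  if k is k'.+1 then
    (-1) ^+ k * q ^+ 'C(k, 2)
      * (gauss (n - k) k + q ^+ (n - k) * gauss (n - k).-1 k')
  else 1.

(** The sum F_n; its summands with n/2 < k vanish. *)
Definition pentsum (n : nat) : R := \sum_(k < n) pentterm n k.

Lemma pentsum1 : pentsum 1 = 1.
Proof. by rewrite /pentsum big_ord1. Qed.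

(** The two halves of pentterm sum to G_n and to - q^(n-1) G_(n-2). *)
Lemma pentsumSS n : pentsum n.+2 = altsum n.+2 - q ^+ n.+1 * altsum n.
Proof.
rewrite /pentsum /altsum [\sum_(k < n.+3) _]big_ord_recr /= subnn mulr0 addr0.
rewrite big_ord_recl [\sum_(k < n.+2) _]big_ord_recl /= ?gauss0 -addrA.
congr (_ + _); first by ring.
rewrite mulr_sumr -sumrB; apply: eq_bigr => i _; rewrite /bump /= add1n.
have le_in : (i <= n)%N by case: i.
have -> : (n.+2 - i.+1 = (n - i).+1)%N by lia.
have -> : q ^+ n.+1 = q ^+ (n - i).+1 * q ^+ i.
  by rewrite -exprD; congr (_ ^+ _); lia.
rewrite binS bin1 exprD !exprS; ring.
Qed.

Lemma pentsum_mod0 m :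
  pentsum (3 * m.+1) = (-1) ^+ m.+1 * (1 + q ^+ m.+1)
                         * q ^+ (3 * 'C(m.+1, 2) + m.+1).
Proof.
rewrite mulnS addnC addn3 pentsumSS altsum_mod1 -(addn3 (3 * m)) addnC -mulnS.
rewrite altsum_mod0.
have -> : (3 * 'C(m.+1, 2) + m.+1 = (3 * 'C(m, 2) + 2 * m) + (2 * m).+1)%N.
  by rewrite binS bin1; lia.
have -> : ((3 * m).+2 = (2 * m).+1 + m.+1)%N by lia.
by rewrite !exprD !exprS; ring.
Qed.

Lemma pentsum_mod1 m :
  pentsum (3 * m).+1 = (-1) ^+ m * q ^+ (3 * 'C(m, 2) + 2 * m).
Proof.
case: m => [|m]; first by rewrite pentsum1 !expr0 mulr1.
rewrite -altsum_mod1 mulnS addnC addn3 pentsumSS altsum_mod2.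
by rewrite mulr0 subr0.
Qed.

Lemma pentsum_mod2 m :
  pentsum (3 * m).+2 = (-1) ^+ m.+1 * q ^+ (3 * 'C(m.+1, 2) + m.+1).
Proof.
rewrite pentsumSS altsum_mod2 altsum_mod0.
have -> : (3 * 'C(m.+1, 2) + m.+1 = (3 * m).+1 + (3 * 'C(m, 2) + m))%N.
  by rewrite binS bin1; lia.
by rewrite !exprD !exprS; ring.
Qed.

End PentagonalSums.

(** * Congruences modulo powers of 1 - q^n *)

Section Congruences.
Variable R : comNzRingType.

Definition eqmod (M a b : R) : Prop := exists c, a = b + M * c.

Lemma eqmod_refl M a : eqmod M a a.
Proof. by exists 0; rewrite mulr0 addr0. Qed.

Lemma eqmodD M a b c d : eqmod M a b -> eqmod M c d -> eqmod M (a + c) (b + d).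
Proof. by move=> [x ->] [y ->]; exists (x + y); ring. Qed.

Lemma eqmodM M a b c d : eqmod M a b -> eqmod M c d -> eqmod M (a * c) (b * d).
Proof.
by move=> [x ->] [y ->]; exists (x * d + b * y + M * x * y); ring.
Qed.

Lemma eqmodMl M c a b : eqmod M a b -> eqmod M (c * a) (c * b).
Proof. by apply: eqmodM; apply: eqmod_refl. Qed.

Lemma eqmod_prod M (I : Type) (r : seq I) (P : pred I) (F G : I -> R) :
    (forall i, P i -> eqmod M (F i) (G i)) ->
  eqmod M (\prod_(i <- r | P i) F i) (\prod_(i <- r | P i) G i).
Proof.
move=> eqFG; elim/big_rec2: _ => [|i x y Pi]; first exact: eqmod_refl.
by apply: eqmodM; apply: eqFG.
Qed.

Lemma eqmod_sum M (I : Type) (r : seq I) (P : pred I) (F G : I -> R) :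
    (forall i, P i -> eqmod M (F i) (G i)) ->
  eqmod M (\sum_(i <- r | P i) F i) (\sum_(i <- r | P i) G i).
Proof.
move=> eqFG; elim/big_rec2: _ => [|i x y Pi]; first exact: eqmod_refl.
by apply: eqmodD; apply: eqFG.
Qed.

(** First-order expansion of u^k at u = 1. *)
Lemma expr_eqmod_sqr (u : R) k :
  eqmod ((1 - u) ^+ 2) (u ^+ k) (1 - k%:R * (1 - u)).
Proof.
elim: k => [|k [c IHk]]; first by rewrite expr0 mul0r subr0; apply: eqmod_refl.
by exists (u * c + k%:R); rewrite exprS IHk -natr1; ring.
Qed.

Variables (q : R) (n : nat).
Local Notation gauss := (gauss q).
Local Notation qfact := (qfact q).
Local Notation qffact := (qffact q).
Local Notation u := (q ^+ n).

(** When k > N the factor 1 - q^0 of the right-hand side corresponds to the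
    factor 1 - q^n of the left-hand side, so both sides are 0 modulo 1 - q^n. *)
Lemma qffact_eqmod N k : eqmod (1 - u) (qffact (n + N) k) (qffact N k).
Proof.
elim: k => [|k IHk]; first by rewrite /qffact !big_ord0; apply: eqmod_refl.
rewrite !qffactSr; have [le_kN|lt_Nk] := leqP k N.
  apply: eqmodM => //; exists (q ^+ (N - k)).
  by rewrite -addnBA // exprD; ring.
move: IHk; rewrite (qffact_small q lt_Nk) => -[c ->].
by exists (c * (1 - q ^+ (n + N - k))); ring.
Qed.

(** Spreading q^(1 + ... + k) over the factors 1 - q^(2n-j) turns them into
    q^j - q^(2n), which is - (1 - q^j) modulo 1 - q^n. *)
Lemma qffact_eqmod_qfact k : (k < n)%N ->
  eqmod (1 - u) (q ^+ 'C(k.+1, 2) * qffact (2 * n).-1 k)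
    ((-1) ^+ k * qfact k).
Proof.
elim: k => [|k IHk] lt_kn.
  by rewrite /qffact /qfact !big_ord0 !expr0; apply: eqmod_refl.
have -> : q ^+ 'C(k.+2, 2) * qffact (2 * n).-1 k.+1
    = q ^+ 'C(k.+1, 2) * qffact (2 * n).-1 k * (q ^+ k.+1 - u ^+ 2).
  have -> : u ^+ 2 = q ^+ k.+1 * q ^+ ((2 * n).-1 - k).
    by rewrite -exprM -exprD; congr (_ ^+ _); lia.
  by rewrite (binS _ 1) bin1 exprD qffactSr; ring.
have -> : (-1) ^+ k.+1 * qfact k.+1 = (-1) ^+ k * qfact k * (q ^+ k.+1 - 1).
  by rewrite qfactS exprS; ring.
by apply: eqmodM; [apply: IHk; lia | exists (1 + u); ring].
Qed.

(** Up to the factors 1 - q^(2n) and 1 - q^n, the two sides are T_k and the k-th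
    term of F_n, each times (q; q)_k^2. The first k factors on the left are
    handled by qffact_eqmod_qfact, using k^2 = C(k,2) + C(k+1,2), and the k - 1
    remaining ones only need q^n = 1. *)
Lemma numerator_eqmod k : (0 < k < n)%N ->
  eqmod (1 - u)
    (q ^+ (k ^ 2) * qffact (2 * n).-1 (k + k).-1)
    ((-1) ^+ k * q ^+ 'C(k, 2) * qfact k * qffact (n - k).-1 k.-1).
Proof.
case: k => // k /andP[_ lt_kn].
have -> : ((k.+1 + k.+1).-1 = k.+1 + k)%N by lia.
rewrite qffactD mulrA; apply: eqmodM; last first.
  have -> : ((2 * n).-1 - k.+1 = n + (n - k.+1).-1)%N by lia.
  exact: qffact_eqmod.
have -> : (k.+1 ^ 2 = 'C(k.+1, 2) + 'C(k.+2, 2))%N.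
  by elim: k {lt_kn} => // k; rewrite !(binS _ 1) !bin1; lia.
rewrite exprD [(-1) ^+ _ * q ^+ _]mulrC -!mulrA; apply: eqmodMl.
exact: qffact_eqmod_qfact.
Qed.

(** The k-th term T_k of the central q-trinomial coefficient of index 2n. *)
Definition trinterm (k : nat) : R :=
  q ^+ (k ^ 2) * gauss (2 * n) k * gauss (2 * n - k) k.

Lemma qfact_sqr_trinterm k : (0 < k < n)%N ->
  qfact k ^+ 2 * trinterm k
  = (1 - u) * (1 + u) * (q ^+ (k ^ 2) * qffact (2 * n).-1 (k + k).-1).
Proof.
case: k => // k /andP[_ lt_kn].
transitivity (q ^+ (k.+1 ^ 2) * qffact (2 * n) (k.+1 + k.+1)).
  by rewrite qffactD -!gauss_qfact /trinterm; ring.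
have -> : (2 * n = (2 * n).-1.+1)%N by lia.
rewrite [(_ + _.+1)%N]addnS qffactS /=.
have -> : q ^+ (2 * n).-1.+1 = u ^+ 2.
  by rewrite -exprM; congr (_ ^+ _); lia.
by ring.
Qed.

Lemma qfact_pentterm k : (0 < k < n)%N ->
  qfact k * pentterm q n k
  = (1 - u) * ((-1) ^+ k * q ^+ 'C(k, 2) * qffact (n - k).-1 k.-1).
Proof.
case: k => // k /andP[_ lt_kn] /=.
transitivity ((-1) ^+ k.+1 * q ^+ 'C(k.+1, 2)
    * (gauss (n - k.+1) k.+1 * qfact k.+1
      + q ^+ (n - k.+1) * (1 - q ^+ k.+1)
        * (gauss (n - k.+1).-1 k * qfact k))).
  by rewrite qfactS; ring.
rewrite !gauss_qfact.
have -> : u = q ^+ (n - k.+1) * q ^+ k.+1.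
  by rewrite -exprD; congr (_ ^+ _); lia.
have -> : (n - k.+1 = (n - k.+1).-1.+1)%N by lia.
by rewrite qffactS /=; ring.
Qed.

(** Both sides contain 1 - q^n, and 1 - q^(2n) = 2 (1 - q^n) modulo (1 - q^n)^2,
    so numerator_eqmod suffices. *)
Lemma trinterm_eqmod k : (0 < k < n)%N ->
  eqmod ((1 - u) ^+ 2) (qfact k ^+ 2 * trinterm k)
    (qfact k ^+ 2 * (2 * pentterm q n k)).
Proof.
move=> k_int; rewrite qfact_sqr_trinterm //.
have [c ->] := numerator_eqmod k_int.
set Z := (-1) ^+ k * _ * _ * _; exists ((1 + u) * c - Z).
have -> : qfact k ^+ 2 * (2 * pentterm q n k)
    = 2 * qfact k * (qfact k * pentterm q n k) by ring.
by rewrite qfact_pentterm // /Z; ring.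
Qed.

Hypothesis n_gt0 : (0 < n)%N.

(** Pascal's rule and symmetry; this avoids dividing by 1 - q^n. *)
Lemma gauss_central : gauss (2 * n) n = (1 + u) * gauss (2 * n).-1 n.-1.
Proof.
move: n_gt0; case: n => // m _.
have -> : (2 * m.+1 = (m.+1 + m).+1)%N by lia.
by rewrite gaussS [_.-1]/= (gauss_sym q m.+1 m); ring.
Qed.

(** The left-hand side is the square of the product of the 1 - u q^j, 0 < j < n.
    Pairing j with n - j, that is x = q^j with y = u/x, the identity
    (1 - u x)(1 - u y) = u (1 - x)(1 - y) + (1 - u)^2 (1 + u) holds. *)
Lemma qffact_sqr_eqmod :
  eqmod ((1 - u) ^+ 2) (qffact (2 * n).-1 n.-1 ^+ 2)
    (u ^+ n.-1 * qfact n.-1 ^+ 2).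
Proof.
have {1}-> : qffact (2 * n).-1 n.-1 ^+ 2 =
   \prod_(j < n.-1) ((1 - u * q ^+ j.+1) * (1 - u * q ^+ (n.-1 - j))).
  rewrite big_split /= expr2; congr (_ * _); last first.
    apply: eq_bigr => j _; rewrite -exprD; congr (1 - _ ^+ _).
    by have := ltn_ord j; lia.
  rewrite /qffact (reindex_inj rev_ord_inj) /=.
  apply: eq_bigr => j _; rewrite -exprD; congr (1 - _ ^+ _).
  by have := ltn_ord j; lia.
have -> : u ^+ n.-1 * qfact n.-1 ^+ 2 =
   \prod_(j < n.-1) (u * ((1 - q ^+ j.+1) * (1 - q ^+ (n.-1 - j)))).
  rewrite !big_split /= prodr_const card_ord expr2; congr (_ * (_ * _)).
  by rewrite -qffactnn.
apply: eqmod_prod => j _; exists (1 + u).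
have -> : u = q ^+ j.+1 * q ^+ (n.-1 - j).
  by rewrite -exprD; congr (_ ^+ _); have := ltn_ord j; lia.
by ring.
Qed.

(** With A the falling product of qffact_sqr_eqmod and P = (q; q)_(n-1), writing
    A = P + (1 - u) d in the congruence for A^2 determines 2 (1 - u) d P, and
    hence (1 + u) A P, without dividing by 2. *)
Lemma central_eqmod :
  eqmod ((1 - u) ^+ 2) (qfact n.-1 ^+ 2 * trinterm n)
    (qfact n.-1 ^+ 2 * (2 - 3 * n%:R * (1 - u))).
Proof.
set P := qfact n.-1.
have -> : P ^+ 2 * trinterm n = u ^+ n * ((1 + u) * P * qffact (2 * n).-1 n.-1).
  rewrite -gauss_qfact -/P /trinterm gauss_central.
  have -> : (2 * n - n = n)%N by lia.
  by rewrite gaussnn -mulnn exprM; ring.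
have [d defA] : eqmod (1 - u) (qffact (2 * n).-1 n.-1) P.
  have -> : ((2 * n).-1 = n + n.-1)%N by lia.
  rewrite /P -qffactnn; exact: qffact_eqmod.
have [c sqA] := qffact_sqr_eqmod.
have [e defu] := expr_eqmod_sqr u n.-1.
have [f defun] := expr_eqmod_sqr u n.
have n1E : n%:R = n.-1%:R + 1 :> R by rewrite natr1 prednK.
have step : eqmod ((1 - u) ^+ 2) ((1 + u) * P * qffact (2 * n).-1 n.-1)
    (P ^+ 2 * (2 - n%:R * (1 - u))).
  move: sqA; rewrite -/P defA defu; set w := 1 - u => sqA.
  exists (e * P ^+ 2 + c - d ^+ 2 - d * P).
  (* Isolate the square of A so that its congruence can be substituted. *)
  have -> : (1 + u) * P * (P + w * d) = (P + w * d) ^+ 2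
      + ((1 - w) * P ^+ 2 - w ^+ 2 * d * (P + d)) by rewrite /w; ring.
  by rewrite sqA n1E; ring.
have [g stepE] := step; rewrite stepE defun.
set w := 1 - u; set N : R := n%:R.
have := eqmodM (ex_intro _ f erefl : eqmod (w ^+ 2) _ (1 - N * w))
  (ex_intro _ g erefl : eqmod (w ^+ 2) _ (P ^+ 2 * (2 - N * w))).
by case=> h ->; exists (N ^+ 2 * P ^+ 2 + h); ring.
Qed.

(** Term by term comparison: the terms 0 < k < n by trinterm_eqmod, the term
    k = n by central_eqmod; those with k > n vanish. *)
Lemma trinomial_eqmod :
  eqmod ((1 - u) ^+ 2) (qfact n.-1 ^+ 2 * \sum_(k < (2 * n).+1) trinterm k)
    (qfact n.-1 ^+ 2 * (2 * pentsum q n - 3 * n%:R * (1 - u) + 1)).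
Proof.
have -> : \sum_(k < (2 * n).+1) trinterm k
    = 1 + (\sum_(1 <= k < n) trinterm k + trinterm n).
  rewrite -(big_mkord xpredT trinterm).
  rewrite (big_cat_nat (n := n.+1)) //=; last by lia.
  rewrite [X in _ + X]big_nat_cond [X in _ + X]big1 => [|k /andP[+ _]].
    rewrite addr0 big_nat_recr //= big_ltn // -addrA.
    by rewrite {1}/trinterm !gauss0 expr0 !mulr1.
  by move=> ?; rewrite /trinterm [gauss (_ - _) _]gauss_small ?mulr0 //; lia.
have -> : 2 * pentsum q n - 3 * n%:R * (1 - u) + 1
   = 1 + (\sum_(1 <= k < n) 2 * pentterm q n k + (2 - 3 * n%:R * (1 - u))).
  rewrite /pentsum -(big_mkord xpredT (pentterm q n)) big_ltn // -mulr_sumr.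
  by rewrite [pentterm q n 0]/=; ring.
rewrite mulrDr [in X in eqmod _ _ X]mulrDr; apply: eqmodD.
  exact: eqmod_refl.
rewrite mulrDr [in X in eqmod _ _ X]mulrDr; apply: eqmodD central_eqmod.
rewrite !mulr_sumr !big_nat; apply: eqmod_sum => k k_int.
have [c defP] : exists c, qfact n.-1 = c * qfact k.
  exists (qffact n.-1 (n.-1 - k)).
  rewrite -!qffactnn; have {2}-> : n.-1 = (n.-1 - k + k)%N by lia.
  by rewrite qffactD; congr (_ * qffact _ _); lia.
rewrite defP exprMn -(mulrA _ _ (trinterm k)) -(mulrA _ _ (2 * _)).
by apply: eqmodMl; apply: trinterm_eqmod.
Qed.

End Congruences.

(** * Cancellation modulo the square of a cyclotomic polynomial *)

(** A nonconstant gcd would have a root in algC. The gcd divides p and r only up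
    to a nonzero integer constant, which does not affect roots. *)
Lemma coprimep_no_common_root (p r : {poly int}) : p != 0 ->
    (forall x : algC,
      root (map_poly intr p) x -> ~~ root (map_poly intr r) x) ->
  coprimep p r.
Proof.
move=> p_neq0 no_root; rewrite coprimep_def.
have intr_inj := @intr_inj algC.
rewrite -(size_map_inj_poly intr_inj) // -[_ == _]negbK.
apply/negP => /closed_rootP[x root_x].
have root_dvd (f : {poly int}) : gcdp p r %| f -> root (map_poly intr f) x.
  rewrite Pdiv.Idomain.dvdp_eq => /eqP.
  move=> /(congr1 (map_poly (intr : int -> algC))).
  rewrite map_polyZ rmorphM => /(congr1 (fun g => root g x)).
  rewrite rootM root_x orbT rootZ //.
  by rewrite intr_eq0 expf_neq0 // lead_coef_eq0 gcdp_eq0 negb_and p_neq0.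
by have := no_root x (root_dvd p (dvdp_gcdl p r)); rewrite root_dvd ?dvdp_gcdr.
Qed.

Lemma coprimep_Cyclotomic_qfact n k : (k < n)%N ->
  coprimep 'Phi_n (qfact 'X k).
Proof.
move=> lt_kn; have n_gt0 : (0 < n)%N by apply: leq_ltn_trans lt_kn.
have [z z_prim] := C_prim_root_exists n_gt0.
apply: coprimep_no_common_root => [|x].
  by rewrite monic_neq0 ?Cyclotomic_monic.
rewrite (Cintr_Cyclotomic z_prim) root_cyclotomic // => x_prim.
rewrite /root /qfact rmorph_prod horner_prod; apply/prodf_neq0 => j _.
rewrite rmorphB rmorph1 rmorphXn /= map_polyX !hornerE subr_eq0 eq_sym.
rewrite -(prim_order_dvd x_prim) gtnNdvd //.
by have := ltn_ord j; lia.
Qed.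

Lemma one_subXn_Cyclotomic n : (0 < n)%N ->
  exists c : {poly int}, 1 - 'X^n = 'Phi_n * c.
Proof.
move=> n_gt0; exists (- \prod_(d <- divisors n | d != n) 'Phi_d).
rewrite mulrN -opprB -(prod_Cyclotomic n_gt0) [in LHS](bigD1_seq n) //=.
  by rewrite -dvdn_divisors.
exact: divisors_uniq.
Qed.

(** A congruence modulo (1 - q^n)^2 holds modulo Phi_n^2, and there
    (q; q)_(n-1)^2 cancels by coprimality; the quotient stays in Z[q] because
    Phi_n^2 is monic. *)
Lemma eqmod_Cyclotomic n (a b : {poly int}) : (0 < n)%N ->
    eqmod ((1 - 'X^n) ^+ 2) (qfact 'X n.-1 ^+ 2 * a) (qfact 'X n.-1 ^+ 2 * b) ->
  eqmod ('Phi_n ^+ 2) a b.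
Proof.
move=> n_gt0 [c eq_ab]; have [d defu] := one_subXn_Cyclotomic n_gt0.
have Phi2_monic : 'Phi_n ^+ 2 \is monic by rewrite monic_exp ?Cyclotomic_monic.
suff /(Pdiv.IdomainMonic.dvdpP Phi2_monic)[e eq_e] : 'Phi_n ^+ 2 %| a - b.
  by exists e; rewrite mulrC -eq_e addrC subrK.
rewrite -(@Gauss_dvdpr _ _ (qfact 'X n.-1 ^+ 2)); last first.
  rewrite coprimep_expl // coprimep_expr //.
  by rewrite coprimep_Cyclotomic_qfact ?prednK.
apply/(Pdiv.IdomainMonic.dvdpP Phi2_monic); exists (d ^+ 2 * c).
by rewrite mulrBr eq_ab defu; ring.
Qed.

(** * From polynomials to rational functions in q *)

Lemma qpoch_qfact k : qpoch 'q k = tofrac (qfact 'X k).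
Proof.
rewrite /qpoch /qfact rmorph_prod; apply: eq_bigr => j _.
by rewrite rmorphB rmorph1 rmorphXn /= exprS.
Qed.

Lemma qpoch_neq0 k : qpoch 'q k != 0.
Proof.
rewrite qpoch_qfact tofrac_eq0; apply/prodf_neq0 => j _.
apply/eqP => /(congr1 (horner^~ 0)) /eqP.
by rewrite !hornerE expr0n subr0 oner_eq0.
Qed.

Lemma qbinom_gauss n k : qbinom n k%:Z = tofrac (gauss 'X n k).
Proof.
rewrite /qbinom le0z_nat lez_nat /=; case: leqP => [le_kn|lt_nk]; last first.
  by rewrite gauss_small // rmorph0.
have -> : `|n%:Z - k%:Z|%N = (n - k)%N by lia.
have den_neq0 : qpoch 'q k * qpoch 'q (n - k) != 0.
  by rewrite mulf_neq0 ?qpoch_neq0.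
apply: (mulIf den_neq0); rewrite divfK // !qpoch_qfact -!rmorphM mulrA.
rewrite gauss_qfact -!qffactnn; congr tofrac.
by rewrite -qffactD subnKC.
Qed.

Lemma qtrinom_trinterm n :
  qtrinom (2 * n) 0 = tofrac (\sum_(k < (2 * n).+1) trinterm 'X n k).
Proof.
rewrite /qtrinom rmorph_sum; apply: eq_bigr => k _.
rewrite !addr0 !qbinom_gauss -PoszM -exprnP mulnn.
by rewrite /trinterm !rmorphM rmorphXn.
Qed.

Lemma qtrinom_congr n (b : {poly int}) : (0 < n)%N ->
    b = 2 * pentsum 'X n - 3 * n%:R * (1 - 'X^n) + 1 ->
  congr_mod (tofrac 'Phi_n ^+ 2) (qtrinom (2 * n) 0) (tofrac b).
Proof.
move=> n_gt0 ->.
have [c defA] := eqmod_Cyclotomic n_gt0 (trinomial_eqmod 'X n_gt0).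
exists (tofrac c); first by exists c, 0; rewrite expr0 divr1.
by rewrite qtrinom_trinterm defA rmorphD addrC addKr rmorphM rmorphXn.
Qed.

(** The pentagonal exponents m (3m - 1)/2 and m (3m + 1)/2 are 3 C(m,2) + m and
    3 C(m,2) + 2m; this evaluates the integer divisions by 2. *)
Lemma mul2_bin2 m : (2 * 'C(m, 2) + m = m * m)%N.
Proof. by elim: m => // m IHm; rewrite binS bin1; lia. Qed.

Theorem theorem1p1 (n : nat) (hn : (0 < n)%N) :
  [/\ forall m : int, n%:Z = 3 * m ->
        congr_mod (tofrac 'Phi_n ^+ 2) (qtrinom (2 * n) 0)
          (2 * (-1) ^ m * (1 + 'q ^ m) * 'q ^ (m * (3 * m - 1) %/ 2)%Z
           - 9 * m%:~R * (1 - 'q ^ (3 * m)) + 1),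
      forall m : int, n%:Z = 3 * m + 1 ->
        congr_mod (tofrac 'Phi_n ^+ 2) (qtrinom (2 * n) 0)
          (2 * (-1) ^ m * 'q ^ (m * (3 * m + 1) %/ 2)%Z
           - 3 * (3 * m + 1)%:~R * (1 - 'q ^ (3 * m + 1)) + 1)
    & forall m : int, n%:Z = 3 * m - 1 ->
        congr_mod (tofrac 'Phi_n ^+ 2) (qtrinom (2 * n) 0)
          (2 * (-1) ^ m * 'q ^ (m * (3 * m - 1) %/ 2)%Z
           - 3 * (3 * m - 1)%:~R * (1 - 'q ^ (3 * m - 1)) + 1)].
Proof.
have tofracE b : 2 * tofrac b - 3 * n%:Z%:~R * (1 - 'q ^ n%:Z) + 1
    = tofrac (2 * b - 3 * n%:R * (1 - 'X^n) + 1 : {poly int}).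
  rewrite -exprnP tofracD tofracB !tofracM tofracB tofracXn.
  by rewrite !tofracMn tofrac1.
have div2 (a : int) (e : nat) : a = e%:Z * 2 -> (a %/ 2)%Z = e%:Z.
  by move=> ->; rewrite mulzK.
split=> -[] m // defn; try lia.
- case: m defn => [|m] defn; first lia.
  have {}defn : n = (3 * m.+1)%N by lia.
  rewrite (div2 _ (3 * 'C(m.+1, 2) + m.+1)%N); last first.
    by have := mul2_bin2 m.+1; lia.
  rewrite (_ : 9 * _ = 3 * n%:Z%:~R :> Qq); last first.
    by rewrite defn PoszM rmorphM /=; ring.
  rewrite (_ : 3 * m.+1%:Z = n%:Z); last by lia.
  rewrite (_ : 2 * _ * _ * _
      = 2 * tofrac (pentsum 'X n)); last first.
    rewrite defn pentsum_mod0 !tofracM tofracD !tofracXn tofracN tofrac1.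
    by rewrite !mulrA.
  by rewrite tofracE; apply: qtrinom_congr.
- have {}defn : n = (3 * m).+1 by lia.
  rewrite (div2 _ (3 * 'C(m, 2) + 2 * m)%N); last first.
    by have := mul2_bin2 m; lia.
  rewrite (_ : 3 * m%:Z + 1 = n%:Z); last by lia.
  rewrite (_ : 2 * _ * _ = 2 * tofrac (pentsum 'X n)); last first.
    by rewrite defn pentsum_mod1 tofracM !tofracXn tofracN tofrac1 mulrA.
  by rewrite tofracE; apply: qtrinom_congr.
- case: m defn => [|m] defn; first lia.
  have {}defn : n = (3 * m).+2 by lia.
  rewrite (div2 _ (3 * 'C(m.+1, 2) + m.+1)%N); last first.
    by have := mul2_bin2 m.+1; lia.
  rewrite (_ : 3 * m.+1%:Z - 1 = n%:Z); last by lia.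
  rewrite (_ : 2 * _ * _ = 2 * tofrac (pentsum 'X n)); last first.
    by rewrite defn pentsum_mod2 tofracM !tofracXn tofracN tofrac1 mulrA.
  by rewrite tofracE; apply: qtrinom_congr.
Qed.
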